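(* Let $\alpha\in(0,1)$. For the Markov chain on $\{R,B\}^{\mathbb{Z}}$ given by the critical two-sided chameleon dynamics on $\mathbb{Z}$ with success probability $\alpha$, the only translation invariant stationary probability measures are of the form $$\kappa\,\delta_{\mathbf R}+(1-\kappa)\,\delta_{\mathbf B}$$ for some $0\le\kappa\le1$.
   Context: Critical two-sided chameleon dynamics on $\mathbb{Z}$ with success probability $\alpha$: time is discrete, $t=0,1,2,\dots$. At time $t$ each site $i\in\mathbb{Z}$ carries a colour $\xi_i(t)\in\{R,B\}$ (red or blue); $\xi(t)=(\xi_i(t))_{i\in\mathbb{Z}}$. Let $\{C_R(i,t)\}_{i\in\mathbb{Z},t\ge0}$ and $\{C_B(i,t)\}_{i\in\mathbb{Z},t\ge0}$ be two independent collections of i.i.d. Bernoulli$(\alpha)$ random variables (coin tosses; $1$ is a success, $0$ is a failure), independent of the initial configuration $\xi(0)$. The coin used at site $i$ at time $t$ is $C_{\xi_i(t)}(i,t)$. Put $N_i=\{i-1,i,i+1\}$. All sites update simultaneously: - If $C_{\xi_i(t)}(i,t)=1$ then $\xi_i(t+1)=\xi_i(t)$. - If $C_{\xi_i(t)}(i,t)=0$, then site $i$ keeps its colour if the proportion of successes among the coins used at time $t$ by the sites in $N_i$ having the same colour as $i$ at time $t$ is larger than or equal to the proportion of successes among the coins used at time $t$ by the sites in $N_i$ having the other colour; otherwise it switches to the other colour. (If no site of $N_i$ has the other colour, that colour's proportion is taken to be $0$, so site $i$ keeps its colour.) Then $(\xi(t))_{t\ge0}$ is a Markov chain with state space $\{R,B\}^{\mathbb{Z}}$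 (with the product $\sigma$-algebra). A probability measure $\mu$ on $\{R,B\}^{\mathbb{Z}}$ is stationary if $\xi(0)\sim\mu$ implies $\xi(1)\sim\mu$, and translation invariant if it is invariant under the shifts of $\mathbb{Z}$. $\delta_{\mathbf R}$ (resp. $\delta_{\mathbf B}$) is the probability measure giving mass $1$ to the configuration with all sites red (resp. all sites blue). *)

(* Defs.v *)
From HB Require Import structures.
From mathcomp Require Import all_boot all_order all_algebra.
From mathcomp Require Import all_classical all_reals all_analysis.

Set Implicit Arguments.
Unset Strict Implicit.
Unset Printing Implicit Defensive.

Import Order.TTheory GRing.Theory Num.Theory.
Local Open Scope classical_set_scope.
Local Open Scope ring_scope.

Notation colour := bool (only parsing).
Notation red := true (only parsing).
Notation blue := false (only parsing).

Definition cylinders : set (set (int -> colour)) :=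
  [set A | exists (i : int) (c : colour), A = [set x | x i = c]].

(* {R,B}^Z with the product sigma-algebra. *)
Notation config := (g_sigma_algebraType cylinders).

Definition all_red : config := fun=> red.
Definition all_blue : config := fun=> blue.

Definition shift (k : int) (x : config) : config := fun i => x (i + k).

Definition neighbourhood (i : int) : seq int := [:: i - 1; i; i + 1].

(* One-step update; [coin c i] is the outcome at site [i] of the coin attached
   to the colour [c], so that site [i] uses [coin (x i) i]. *)
Section update.
Variables (coin : colour -> int -> bool) (x : config).

(* Proportion of successes among the sites of N_i of colour [c]; it is 0 when
   there is no such site, since 0^-1 = 0. *)
Definition success_proportion (i : int) (c : colour) : rat :=
  (count (fun j => (x j == c) && coin (x j) j) (neighbourhood i))%:R /
  (count (fun j => x j == c) (neighbourhood i))%:R.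

Definition update : config := fun i =>
  if coin (x i) i then x i
  else if success_proportion i (~~ x i) <= success_proportion i (x i) then x i
  else ~~ x i.

End update.

Section probability_notions.
Context d (Omega : measurableType d) (R : realType) (P : probability Omega R).

(* Mutual independence of a family of set systems (in practice, of
   sigma-algebras): the product rule holds on all finite subfamilies. *)
Definition mutually_independent (I : eqType) (F : I -> set (set Omega)) :=
  forall (s : seq I) (A : I -> set Omega), uniq s ->
    (forall i, i \in s -> F i (A i)) ->
    P (\bigcap_(i in [set` s]) A i) = (\prod_(i <- s) P (A i))%E.

(* Laws are compared on measurable sets only: measures are functions on all
   sets, with irrelevant values outside the sigma-algebra. *)
Definition has_law d' (T : measurableType d') (X : {RV P >-> T})
    (mu : set T -> \bar R) :=
  forall A, measurable A -> distribution P X A = mu A.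

(* The index [None] stands for the initial configuration and [Some (c, i, t)]
   for the coin C_c(i, t). *)
Definition source_sigma_algebra (xi0 : {RV P >-> config})
    (C : colour -> int -> nat -> {RV P >-> bool})
    (k : option (colour * int * nat)) : set (set Omega) :=
  match k with
  | None => g_sigma_algebra_preimage xi0
  | Some (c, i, t) => g_sigma_algebra_preimage (C c i t)
  end.

Record chameleon_dynamics (alpha : R) (xi : nat -> {RV P >-> config})
    (C : colour -> int -> nat -> {RV P >-> bool}) : Prop := {
  coins_bernoulli : forall c i t, has_law (C c i t) (bernoulli_prob alpha) ;
  sources_independent : mutually_independent (source_sigma_algebra (xi 0%N) C) ;
  dynamics_update : forall t w,
    xi t.+1 w = update (fun c i => C c i t w) (xi t w)
}.

End probability_notions.

Definition stationary (R : realType) (alpha : R) (mu : probability config R) :=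
  forall (d : measure_display) (Omega : measurableType d)
    (P : probability Omega R) (xi : nat -> {RV P >-> config})
    (C : colour -> int -> nat -> {RV P >-> bool}),
  chameleon_dynamics alpha xi C -> has_law (xi 0%N) mu -> has_law (xi 1%N) mu.

Definition translation_invariant (R : realType) (mu : probability config R) :=
  forall (k : int) (A : set config), measurable A -> mu (shift k @^-1` A) = mu A.

(* Main.v *)
From HB Require Import structures.
Require Import Defs.
From mathcomp Require Import all_boot all_order all_algebra.
From mathcomp Require Import all_classical all_reals all_analysis.
From mathcomp Require Import measurable_realfun ring lra zify.

Set Implicit Arguments.
Unset Strict Implicit.
Unset Printing Implicit Defensive.

Import Order.TTheory GRing.Theory Num.Theory.
Local Open Scope classical_set_scope.
Local Open Scope ring_scope.

(* A site changes colour exactly when its own coin fails and a neighbour of the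
   other colour succeeds.  Hence an interface (a bond joining sites of different
   colours) moves right when its endpoints toss (1, 0), left when they toss
   (0, 1), and stays otherwise; interfaces can meet and disappear but are never
   created.  As the coins in use are i.i.d. given the configuration, comparing
   the interface densities at times 0 and 1 under a translation invariant
   stationary law shows that no meeting occurs almost surely, so two interfaces
   are almost surely not adjacent.  An interface can move one step towards the
   next one with positive probability, so by induction no two interfaces are at
   finite distance; the events "there is an interface at i" are then almost
   surely disjoint and equiprobable, hence null.

   Using stationarity requires some realization of the dynamics: all the coins
   are read off one uniform variable on [0, 1], through its digits for the map
   that stretches [0, alpha[ and [alpha, 1[ onto [0, 1[. *)

(** * The update in Boolean form, and measurability of local events *)

(** Suppose the coin at [i] fails and some neighbour has the other colour. If the other neighbour
    agrees with [i], the proportion for the colour of [i] is at most 1/2 and the opposing one is 0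
    or 1; if neither agrees, the former is 0. So the comparison only depends on whether some
    opposing neighbour succeeds. *)
Lemma updateE (coin : colour -> int -> bool) (x : config) (i : int) :
  update coin x i = x i (+) (~~ coin (x i) i &&
    (((x (i - 1) != x i) && coin (x (i - 1)) (i - 1)) ||
     ((x (i + 1) != x i) && coin (x (i + 1)) (i + 1)))).
Proof.
rewrite /update /success_proportion /neighbourhood /=.
move: (coin (x i) i) (coin (x (i - 1)) _) (coin (x (i + 1)) _).
by move: (x i) (x (i - 1)) (x (i + 1)) => [] [] [] [] [] [].
Qed.

(** The four alternatives are arrival from the left bond, staying with two failures or with two
    successes, and arrival from the right bond. Only an implication can hold, since two interfaces
    reaching the same bond annihilate. *)
Lemma interface_moves (x0 x1 x2 x3 u0 u1 u2 u3 : bool) :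
  x1 (+) ~~ u1 && ((x0 != x1) && u0 || (x2 != x1) && u2)
  != x2 (+) ~~ u2 && ((x1 != x2) && u1 || (x3 != x2) && u3) ->
  [|| [&& x0 != x1, u0 & ~~ u1], [&& x1 != x2, ~~ u1 & ~~ u2],
      [&& x1 != x2, u1 & u2] | [&& x2 != x3, ~~ u2 & u3]].
Proof. by case: x0 x1 x2 x3 u0 u1 u2 u3 => [] [] [] [] [] [] [] []. Qed.

Lemma measurable_truth_set d (T : measurableType d) (f : T -> bool) :
  measurable_fun [set: T] f -> measurable [set x | f x].
Proof. by move=> mf; rewrite -[X in measurable X]setTI; exact: mf. Qed.

Lemma measurable_eqb d (T : measurableType d) (f g : T -> bool) :
  measurable_fun [set: T] f -> measurable_fun [set: T] g ->
  measurable_fun [set: T] (fun x => f x == g x).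
Proof.
move=> mf mg.
rewrite (_ : (fun _ => _) = (fun x => if f x then g x else ~~ g x)); last first.
  by apply/funext => x; case: (f x); case: (g x).
by apply: measurable_fun_ifT => //; exact: measurable_neg.
Qed.

Lemma measurable_all d (T : measurableType d) (I : Type) (s : seq I)
    (f : I -> T -> bool) :
  (forall i, measurable_fun [set: T] (f i)) ->
  measurable_fun [set: T] (fun x => all (f^~ x) s).
Proof.
by move=> mf; elim: s => [|i s IHs] /=; [exact: measurable_cst|exact: measurable_and].
Qed.

Lemma measurable_coordinate_eq (i : int) (c : colour) :
  measurable [set x : config | x i = c].
Proof. by apply: sub_sigma_algebra; exists i, c. Qed.

Lemma measurable_coordinate (i : int) :
  measurable_fun [set: config] (fun x : config => x i : bool).
Proof.
apply: (measurable_fun_bool true); rewrite setTI.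
exact: measurable_coordinate_eq i true.
Qed.

Definition interface (i : int) : set config := [set x | x i != x (i + 1)].

Lemma measurable_interface (i : int) : measurable (interface i).
Proof.
apply: measurable_truth_set; apply: measurable_neg.
by apply: measurable_eqb; exact: measurable_coordinate.
Qed.

Lemma full_measure_setI d (T : measurableType d) (R : realType)
    (P : probability T R) (G X : set T) : measurable G -> P (~` G) = 0%E ->
  measurable X -> P X = P (X `&` G).
Proof.
move=> mG PG0 mX; rewrite (measureDI P mX mG).
rewrite [X in (X + _)%E](_ : _ = 0%E) ?add0e//.
apply: (@subset_measure0 _ _ _ _ _ (~` G)) => //.
- exact: measurableD.
- exact: measurableC.
Qed.

(** * Interfaces under a stationary law *)

Section used_coins.
Context d (Omega : measurableType d) (R : realType) (P : probability Omega R).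
Variables (alpha : R) (xi : nat -> {RV P >-> config}).
Variable (C : colour -> int -> nat -> {RV P >-> bool}).
Hypothesis alpha01 : 0 < alpha < 1.
Hypothesis dyn : chameleon_dynamics alpha xi C.
Variable mu : probability config R.
Hypothesis xi0_law : has_law (xi 0%N) mu.

Definition used_coin (w : Omega) (i : int) : bool := C (xi 0%N w i) i 0%N w.

Definition coin_weight (b : bool) : R := if b then alpha else 1 - alpha.

Lemma measurable_used_coin (i : int) :
  measurable_fun [set: Omega] (used_coin^~ i).
Proof.
rewrite (_ : used_coin^~ i = (fun w => if xi 0%N w i then C true i 0%N w else C false i 0%N w)).
  apply: measurable_fun_ifT => //.
  exact: (measurableT_comp (measurable_coordinate i)).
by apply/funext => w; rewrite /used_coin; case: (xi 0%N w i).
Qed.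

Lemma coin_prob (c : colour) (i : int) (t : nat) (b : bool) :
  P (C c i t @^-1` [set b]) = (coin_weight b)%:E.
Proof.
have := coins_bernoulli dyn c i t; move=> /(_ [set b] I).
rewrite /distribution /pushforward => ->; rewrite bernoulli_probE; last first.
  by case/andP: alpha01 => /ltW -> /ltW.
rewrite !diracE /coin_weight; case: b.
  by rewrite mem_set// memNset//= mule1 mule0 adde0.
by rewrite memNset// mem_set//= mule1 mule0 add0e.
Qed.

Let pinned (v : int -> bool) (l : seq (colour * int)) : set Omega :=
  [set w | all (fun p => C p.1 p.2 0%N w == v p.2) l].

Definition used_coins_event (v : int -> bool) (s : seq int) : set Omega :=
  [set w | all (fun i => used_coin w i == v i) s].

Lemma measurable_used_coins_event (v : int -> bool) (s : seq int) :
  measurable (used_coins_event v s).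
Proof.
apply: measurable_truth_set; apply: measurable_all => j.
by apply: measurable_eqb => //; exact: measurable_used_coin.
Qed.

(* Once the colour of site i is prescribed, the coin used at i is a coin of a
   fixed colour: it moves from s to the list l of such coins. *)
Let used_coins_aux (v : int -> bool) (s : seq int) :
  forall (l : seq (colour * int)) (A : set config), measurable A ->
  uniq l -> uniq s -> (forall p, p \in l -> p.2 \notin s) ->
  P (xi 0%N @^-1` A `&` pinned v l `&` used_coins_event v s) =
  (mu A * (\prod_(p <- l) coin_weight (v p.2))%:E
        * (\prod_(i <- s) coin_weight (v i))%:E)%E.
Proof.
elim: s => [|i s IHs] l A mA ul us ls.
  (* With [s] exhausted, independence of the sources applies to the initial configuration, indexed
     by [None], and the distinct coins of [l]. *)
  rewrite big_nil mule1 (_ : used_coins_event v [::] = setT) ?setIT//; last exact/seteqP.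
  pose k0 (p : colour * int) := Some (p.1, p.2, 0%N).
  pose F k := if k is Some (c, j, t) then C c j t @^-1` [set v j]
              else xi 0%N @^-1` A.
  have := sources_independent dyn (s := None :: map k0 l) (A := F).
  rewrite big_cons big_map /=.
  have -> : \bigcap_(k in [set` None :: map k0 l]) F k =
            xi 0%N @^-1` A `&` pinned v l.
    apply/seteqP; split=> w /=.
      move=> h; split; first by apply: (h None); rewrite /= mem_head.
      apply/allP => p pl; apply/eqP; apply: (h (k0 p)).
      by rewrite /= inE map_f.
    move=> [hA /allP hl] k /=; rewrite inE => /orP[/eqP->//|/mapP[p pl ->]].
    exact/eqP/hl.
  move=> ->.
  - rewrite -xi0_law//; congr (_ * _)%E.
    rewrite (eq_bigr (fun p => (coin_weight (v p.2))%:E)) ?prodEFin//.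
    by move=> p _; exact: coin_prob.
  - rewrite map_inj_uniq// ?ul ?andbT; first by apply/mapP => -[].
    by move=> [a b] [c e] [-> ->].
  - move=> k; rewrite inE => /orP[/eqP->|/mapP[p pl ->]] /=.
      by exists A => //; rewrite setTI.
    by exists [set v p.2] => //; rewrite setTI.
have split_colour : xi 0%N @^-1` A `&` pinned v l `&` used_coins_event v (i :: s) =
  (xi 0%N @^-1` (A `&` [set x | x i = true]) `&` pinned v ((true, i) :: l)
     `&` used_coins_event v s) `|`
  (xi 0%N @^-1` (A `&` [set x | x i = false]) `&` pinned v ((false, i) :: l)
     `&` used_coins_event v s).
  rewrite /used_coins_event/pinned; apply/seteqP; split=> w /=; rewrite /used_coin.
    move=> [[Aw ->] /andP[+ ->]].
    by case: (xi 0%N w i) => ->; [left|right].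
  by move=> [] [[[Aw wi] /andP[wv ->]] ->]; rewrite wi wv.
have mpart c : measurable
  (xi 0%N @^-1` (A `&` [set x | x i = c]) `&` pinned v ((c, i) :: l) `&` used_coins_event v s).
  apply: measurableI; last exact: measurable_used_coins_event.
  apply: measurableI.
    apply: measurable_funPTI; apply: measurableI => //.
    exact: measurable_coordinate_eq.
  apply: measurable_truth_set; apply: measurable_all => j.
  exact: measurable_eqb.
rewrite split_colour measureU//; last first.
  apply/seteqP; split=> w //= [[[[_ wt] _] _] [[[_ wf] _] _]].
  by rewrite wt in wf.
move: us => /= /andP[si us].
have mAc c : measurable (A `&` [set x | x i = c]).
  by apply: measurableI => //; exact: measurable_coordinate_eq.
have IH c : P (xi 0%N @^-1` (A `&` [set x | x i = c])
      `&` pinned v ((c, i) :: l) `&` used_coins_event v s) =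
    (mu (A `&` [set x | x i = c])
     * (\prod_(p <- (c, i) :: l) coin_weight (v p.2))%:E
     * (\prod_(j <- s) coin_weight (v j))%:E)%E.
  apply: IHs => //.
    rewrite /= ul andbT; apply/negP => /ls.
    by rewrite inE eqxx.
  move=> p; rewrite inE => /orP[/eqP->//|/ls].
  by rewrite inE negb_or => /andP[].
(* The weight of a coin does not depend on its colour, so the two halves recombine into [mu A]. *)
have muA : mu A = (mu (A `&` [set x | x i = true]) +
                   mu (A `&` [set x | x i = false]))%E.
  rewrite -measureU//; last first.
    by apply/seteqP; split=> x //= [[_ ->] []].
  congr (mu _); rewrite -setIUr; apply/esym/setIidPl => x _ /=.
  by case: (x i); [left|right].
rewrite !IH muA !big_cons /=.
rewrite -(fineK (fin_num_measure mu _ (mAc true))).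
rewrite -(fineK (fin_num_measure mu _ (mAc false))).
rewrite -!EFinM -!EFinD; congr EFin; ring.
Qed.

(** Which coin a site reads depends on the initial configuration, but both colours have the same
    success probability: the coins in use are therefore i.i.d. and independent of that
    configuration. *)
Lemma used_coins_law (v : int -> bool) (s : seq int) (A : set config) :
  measurable A -> uniq s ->
  P (xi 0%N @^-1` A `&` used_coins_event v s) =
  (mu A * (\prod_(i <- s) coin_weight (v i))%:E)%E.
Proof.
move=> mA us; have := @used_coins_aux v s [::] A mA isT us.
rewrite big_nil mule1 => <- //; congr (P (_ `&` _)).
by rewrite (_ : pinned v [::] = setT) ?setIT//; exact/seteqP.
Qed.

Lemma next_colour (w : Omega) (i : int) (x := xi 0%N w) (u := used_coin w) :
  xi 1%N w i = x i (+) (~~ u i &&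
    (((x (i - 1) != x i) && u (i - 1)) || ((x (i + 1) != x i) && u (i + 1)))).
Proof. by rewrite (dynamics_update dyn) updateE. Qed.

Hypothesis xi1_law : has_law (xi 1%N) mu.
Hypothesis mu_shift : translation_invariant mu.

Lemma measurable_pullback (A : set config) (v : int -> bool) (s : seq int) :
  measurable A -> measurable (xi 0%N @^-1` A `&` used_coins_event v s).
Proof.
move=> mA; apply: measurableI; last exact: measurable_used_coins_event.
exact: measurable_funPTI.
Qed.

Lemma interface_density (i : int) : mu (interface i) = mu (interface 0).
Proof.
rewrite -(mu_shift i (measurable_interface 0)); congr (mu _).
by apply/seteqP; split=> x; rewrite /interface /Defs.shift /= !add0r (addrC 1).
Qed.

Lemma adjacent_interfaces_null : mu (interface 0 `&` interface 1) = 0%E.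
Proof.
(* An interface reaches bond 1 by moving right from bond 0 (R0), staying (S) or
   moving left from bond 2 (L2); two interfaces in R0 and S false annihilate. *)
pose R0 := xi 0%N @^-1` interface 0 `&` used_coins_event (pred1 0) [:: 0; 1].
pose L2 := xi 0%N @^-1` interface 2 `&` used_coins_event (pred1 3) [:: 2; 3].
pose S c := xi 0%N @^-1` interface 1 `&` used_coins_event (fun=> c) [:: 1; 2].
pose mE i := measurable_interface i.
have incl : xi 1%N @^-1` interface 1 `<=` (R0 `|` S false) `|` (S true `|` L2).
  move=> w; rewrite /R0 /L2 /S /interface /used_coins_event /= !next_colour.
  rewrite (_ : 1 - 1 = 0)// (_ : 1 + 1 = 2)// (_ : 2 - 1 = 1)// (_ : 2 + 1 = 3)//.
  rewrite (_ : 0 + 1 = 1 :> int)//.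
  move: (xi 0%N w) (used_coin w) => x u.
  move=> /interface_moves /or4P[] /and3P[-> u1 u2].
  - by left; left; rewrite u1 (negbTE u2).
  - by left; right; rewrite (negbTE u1) (negbTE u2).
  - by right; left; rewrite u1 u2.
  - by right; right; rewrite (negbTE u1) u2.
have RS : R0 `&` S false = xi 0%N @^-1` (interface 0 `&` interface 1) `&`
    used_coins_event (pred1 0) [:: 0; 1; 2].
  apply/seteqP; split=> w; rewrite /R0 /S /used_coins_event /=.
    by move=> [[e0 /and3P[-> -> _]] [e1 /and3P[_ -> _]]].
  by move=> [[e0 e1] /and4P[-> -> -> _]].
have mR0 : measurable R0 by exact: measurable_pullback.
have mL2 : measurable L2 by exact: measurable_pullback.
have mS c : measurable (S c) by exact: measurable_pullback.
have : (P (xi 1%N @^-1` interface 1) <= P (R0 `|` S false `|` (S true `|` L2)))%E.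
  apply: le_measure => //; rewrite inE; first exact: measurable_funPTI.
  by do 2?[apply: measurableU].
have -> : P (xi 1%N @^-1` interface 1) = mu (interface 0).
  by rewrite -(interface_density 1) -xi1_law.
(* The overlap of [R0] and [S false] is kept exactly; the other overlaps are simply bounded by
   subadditivity. *)
have : (P (R0 `|` S false `|` (S true `|` L2)) <=
        P R0 + P (S false) - P (R0 `&` S false) + (P (S true) + P L2))%E.
  rewrite -measureUfinr ?ltey_eq ?fin_num_measure//.
  apply: le_trans (measureU2 _ _ _) _; do ?exact: measurableU.
  by rewrite leeD2l// measureU2.
rewrite RS !used_coins_law//; last exact: measurableI.
rewrite !interface_density !big_cons !big_nil /coin_weight /=.
have f1 := fin_num_measure mu _ (mE 0).
have f2 := fin_num_measure mu _ (measurableI _ _ (mE 0) (mE 1)).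
rewrite -(fineK f1) -(fineK f2).
set D := fine _; set K := fine _.
rewrite -!EFinM -!EFinD => upper lower.
(* The four moves have total weight 2 alpha (1 - alpha) + (1 - alpha)^2 + alpha^2 = 1, so this reads
   D <= D - K alpha (1 - alpha)^2. *)
have := le_trans lower upper; rewrite lee_fin => DK.
have K0 : 0 <= K by rewrite /K fine_ge0.
have [a0 a1] := andP alpha01.
have : K * (alpha * (1 - alpha) ^+ 2) <= 0 by lra.
rewrite pmulr_lle0 ?mulr_gt0 ?exprn_gt0 ?subr_gt0// => K'0.
by congr EFin; apply/le_anti; rewrite K'0.
Qed.

Lemma interface_pair_shift (i k : int) :
  mu (interface i `&` interface (i + k)) = mu (interface 0 `&` interface k).
Proof.
have mI := measurableI _ _ (measurable_interface 0) (measurable_interface k).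
rewrite -(mu_shift i mI); congr (mu _).
by apply/seteqP; split=> x; rewrite /interface /Defs.shift /= !add0r (addrC 1)
  (addrAC k) (addrC k).
Qed.

Lemma coin_weight_gt0 (b : bool) : 0 < coin_weight b.
Proof. by have [a0 a1] := andP alpha01; case: b; rewrite /= ?subr_gt0. Qed.

(** In the inductive step, a third interface at 1 falls under the adjacent case. Without it,
    suitable coins of positive weight bring the pair one step closer at time 1, an event that is
    null by stationarity and induction. *)
Lemma interface_pair_null (n : nat) :
  mu (interface 0 `&` interface n.+1%:Z) = 0%E.
Proof.
elim: n => [|n IHn]; first exact: adjacent_interfaces_null.
pose mE i := measurable_interface i.
pose A := interface 0 `&` interface n.+2%:Z `\` interface 1.
have mA : measurable A by apply: measurableD => //; exact: measurableI.
(* With these coins the interface at 0 moves to 1 and the one at n + 2 stays. *)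
pose v (j : int) := j != 1.
(* For n = 0 the sites 2 and n + 2 coincide, hence [undup]. *)
pose s := undup [:: 0; 1; 2; n.+2%:Z; n.+2%:Z + 1].
have muA : mu A = 0%E.
  have : (mu A * (\prod_(i <- s) coin_weight (v i))%:E <= 0)%E.
    rewrite -used_coins_law ?undup_uniq// -IHn -(interface_pair_shift 1).
    rewrite -xi1_law; last by apply: measurableI.
    apply: le_measure; rewrite ?inE; [exact: measurable_pullback| |].
      by apply: measurable_funPTI; exact: measurableI.
    move=> w [[[/= e0 en] /negP/negPn/eqP e1] /allP uv].
    have uE i : i \in [:: 0; 1; 2; n.+2%:Z; n.+2%:Z + 1] -> used_coin w i = v i.
      by rewrite -mem_undup => /uv/eqP.
    have [u0 u1 u2] : [/\ used_coin w 0, ~~ used_coin w 1 & used_coin w 2].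
      by rewrite !uE.
    have [un un1] : used_coin w n.+2%:Z /\ used_coin w (n.+2%:Z + 1).
      rewrite !uE ?inE ?eqxx ?orbT// /v; lia.
    have -> : 1 + n.+1%:Z = n.+2%:Z by lia.
    rewrite /interface /= !next_colour (_ : 1 - 1 = 0)// (_ : 1 + 1 = 2)//.
    rewrite u0 (negbTE u1) u2 un un1 /= !addbF; split=> //.
    rewrite e0 /= -e1.
    by move: e0; case: (xi 0%N w 1).
  rewrite -(fineK (fin_num_measure mu _ mA)) -EFinM lee_fin.
  rewrite pmulr_lle0 ?prodr_gt0// => [A0|i _]; last exact: coin_weight_gt0.
  by congr EFin; apply/le_anti; rewrite A0 fine_ge0.
apply: (@subset_measure0 _ _ _ _ _ (A `|` (interface 0 `&` interface 1))).
- exact: measurableI.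
- by apply: measurableU => //; exact: measurableI.
- move=> x [x0 xn]; have [x1|x1] := pselect (interface 1 x); first by right.
  by left.
- apply: null_set_setU => //; first exact: measurableI.
  exact: adjacent_interfaces_null.
Qed.

(** Pairwise intersections are null, so the probabilities of these equiprobable events add up. *)
Lemma interface_union_measure (n : nat) :
  fine (mu (\big[setU/set0]_(0 <= i < n) interface i%:Z)) =
  n%:R * fine (mu (interface 0)).
Proof.
elim: n => [|n IHn]; first by rewrite big_nil measure0 mul0r.
have mU : measurable (\big[setU/set0]_(0 <= i < n) interface i%:Z).
  by apply: bigsetU_measurable => i _; exact: measurable_interface.
have [mE0 mEn] := (measurable_interface 0, measurable_interface n).
pose U := \big[setU/set0]_(0 <= i < n) interface i%:Z.
suff UEn : mu (U `&` interface n) = 0%E.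
  have -> : mu (\big[setU/set0]_(0 <= i < n.+1) interface i%:Z) =
      (mu U + mu (interface 0))%E.
    rewrite big_nat_recr//= measureUfinr ?ltey_eq ?fin_num_measure//.
    rewrite -[in RHS](interface_density n).
    by rewrite [X in (_ - X)%E](_ : _ = 0%E)// sube0.
  by rewrite fineD ?fin_num_measure// IHn -natr1 mulrDl mul1r.
apply: measure_negligible; first exact: measurableI.
rewrite big_distrl big_nat_cond; apply: negligible_bigsetU => k.
move=> /andP[/andP[_ kn] _].
apply/negligibleP; first by apply: measurableI => //; exact: measurable_interface.
rewrite -(interface_pair_null (n - k).-1) -(interface_pair_shift k).
by congr (mu (_ `&` interface _)); lia.
Qed.

Lemma interface_null (i : int) : mu (interface i) = 0%E.
Proof.
rewrite interface_density.
have fD := fin_num_measure mu _ (measurable_interface 0).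
rewrite -(fineK fD); congr EFin; apply/le_anti; rewrite fine_ge0// andbT.
rewrite leNgt; apply/negP => D0.
(* More than 1/D almost surely disjoint events of probability D would have total mass above 1. *)
have nD := archi_boundP (ltW (divr_gt0 ltr01 D0)); set n := Num.bound _ in nD.
pose U := \big[setU/set0]_(0 <= i < n) interface i%:Z.
have mU : measurable U.
  by apply: bigsetU_measurable => k _; exact: measurable_interface.
have : fine (mu U) <= 1.
  by rewrite -lee_fin fineK ?fin_num_measure//; exact: probability_le1.
rewrite interface_union_measure leNgt => /negP; apply.
by rewrite -ltr_pdivrMr.
Qed.

End used_coins.

(** * Monochromatic configurations *)

Lemma no_interface_constant (x : config) :
  (forall i, ~ interface i x) -> x = all_red \/ x = all_blue.
Proof.
move=> noI; have step i : x i = x (i + 1) by apply/eqP/negPn/negP/noI.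
have x0 i : x i = x 0.
  elim/int_ind: i => [//|n IHn|n IHn].
    by rewrite -IHn (step n%:Z); congr x; lia.
  by rewrite -IHn (step (- n.+1%:Z)); congr x; lia.
by case: (x 0) x0 => x0; [left|right]; apply/funext.
Qed.

Lemma measurable_all_colour (c : colour) : measurable [set (fun=> c) : config].
Proof.
(* Pairing the sites n and -n makes the intersection over Z one over [nat]. *)
rewrite (_ : [set _] = \bigcap_n ([set x : config | x n%:Z = c] `&`
                                  [set x : config | x (- n%:Z) = c])).
  by apply: bigcapT_measurable => n; apply: measurableI;
    exact: measurable_coordinate_eq.
apply/seteqP; split=> [x -> //|x xc]; apply/funext => i.
by case: (intP i) => [|n|n]; [have [] := xc 0%N I|
  have [] := xc n.+1 I|have [] := xc n.+1 I].
Qed.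

(** A configuration that is not monochromatic has an interface at some site, and a countable union
    of null events is null. *)
Lemma monochrome_measure (R : realType) (mu : probability config R)
    (A : set config) : measurable A ->
  (forall i, mu (interface i) = 0%E) ->
  mu A = (mu (A `&` [set all_red]) + mu (A `&` [set all_blue]))%E.
Proof.
move=> mA I0; have mE i := measurable_interface i.
have mr := measurable_all_colour true; have mb := measurable_all_colour false.
have N0 : mu.-negligible (~` ([set all_red] `|` [set all_blue])).
  apply: (@negligibleS _ _ _ _
    (\bigcup_n (interface n%:Z `|` interface (- n%:Z)))); last first.
    apply: negligible_bigcup => n; apply/negligibleP.
      by apply: measurableU; exact: mE.
    by apply: null_set_setU; [exact: mE|exact: mE|exact: I0|exact: I0].
  move=> x xN; apply: contrapT => noI; apply: xN; apply: no_interface_constant.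
  move=> i xi; apply: noI.
  by case: (intP i) xi => [|n|n] xi; [exists 0%N|exists n.+1|exists n.+1] => //;
    by [left|right].
rewrite -measureU//; do ?exact: measurableI; last first.
  apply/seteqP; split=> x //= [[_ ->] [_ /(congr1 (fun x => x 0))]].
  by [].
rewrite -setIUr; apply: full_measure_setI => //; first exact: measurableU.
by apply: measure_negligible => //; apply: measurableC; exact: measurableU.
Qed.

Lemma monochrome_mixture (R : realType) (mu : probability config R) :
  (forall A, measurable A -> mu A =
     (mu (A `&` [set all_red]) + mu (A `&` [set all_blue]))%E) ->
  exists kappa : R, 0 <= kappa <= 1 /\
    forall A : set config, measurable A ->
      mu A = (kappa%:E * \d_all_red A + (1 - kappa)%:E * \d_all_blue A)%E.
Proof.
move=> muE.
have mr : measurable [set all_red] := measurable_all_colour true.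
have mb : measurable [set all_blue] := measurable_all_colour false.
have fr := fin_num_measure mu _ mr; have fb := fin_num_measure mu _ mb.
have rb1 : fine (mu [set all_red]) + fine (mu [set all_blue]) = 1.
  apply: EFin_inj; rewrite EFinD !fineK// -(probability_setT mu).
  by rewrite (muE _ measurableT) !setTI.
(* Restricted to a point, [mu] is a multiple of the Dirac mass there; kappa is thus the mass of
   [all_red]. *)
have pt (x : config) (A : set config) : measurable [set x] ->
    mu (A `&` [set x]) = (mu [set x] * \d_x A)%E.
  move=> mx; rewrite diracE; have [Ax|nAx] := boolP (x \in A).
    by rewrite mule1 setIidr// => y ->; exact/set_mem.
  rewrite mule0 (_ : _ `&` _ = set0) ?measure0//.
  by apply/seteqP; split=> y //= [Ay yx]; move: nAx; rewrite -yx mem_set.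
exists (fine (mu [set all_red])); split.
  by have := fine_ge0 (measure_ge0 mu [set all_blue]); have := fine_ge0 (measure_ge0 mu [set all_red]); lra.
move=> A mA; rewrite (muE _ mA) !pt// -{1}(fineK fr) -{1}(fineK fb).
by congr (_ + _%:E * _)%E; lra.
Qed.

(** * Invariance and stationarity of the mixtures *)

Lemma measurable_fun_config d (T : measurableType d) (f : T -> config) :
  (forall i, measurable_fun [set: T] (fun w => f w i : bool)) ->
  measurable_fun [set: T] f.
Proof.
move=> mf; apply: (@measurability _ _ T config setT f cylinders) => // _ [_ [i [c ->]] <-].
exact: (mf i measurableT [set c]).
Qed.

Lemma measurable_shift (k : int) : measurable_fun [set: config] (Defs.shift k).
Proof. by apply: measurable_fun_config => i; exact: measurable_coordinate. Qed.

Lemma update_constant (coin : colour -> int -> bool) (c : colour) :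
  update coin (fun=> c) = fun=> c.
Proof. by apply/funext => i; rewrite updateE eqxx andbF addbF. Qed.

Section mixtures.
Context (R : realType) (mu : probability config R) (kappa : R).
Hypothesis muE : forall A : set config, measurable A ->
  mu A = (kappa%:E * \d_all_red A + (1 - kappa)%:E * \d_all_blue A)%E.

Lemma mixture_translation_invariant : translation_invariant mu.
Proof.
move=> k A mA; rewrite !muE//.
by rewrite -[X in measurable X]setTI; exact: measurable_shift.
Qed.

(** Almost surely the initial configuration is monochromatic, hence fixed by the update whatever the
    coins. Intersecting with this event makes the events at times 0 and 1 equal. *)
Lemma mixture_stationary (alpha : R) : stationary alpha mu.
Proof.
move=> d Omega P xi C dyn law0 A mA.
pose G : set config := [set all_red] `|` [set all_blue].
have mG : measurable G.
  by apply: measurableU; exact: measurable_all_colour.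
have mX t B : measurable B -> measurable (xi t @^-1` B).
  by move=> mB; exact: measurable_funPTI.
have muG0 : mu (~` G) = 0%E.
  rewrite muE; last exact: measurableC.
  by rewrite !diracE !memNset ?mule0 ?adde0//= => -[]; [right|left].
rewrite -law0//= /distribution /pushforward.
have PG t : P (xi t @^-1` A) = P (xi t @^-1` A `&` xi 0%N @^-1` G).
  apply: full_measure_setI; [exact: mX| |exact: mX].
  by rewrite preimage_setC -muG0 -law0//; exact: measurableC.
rewrite !PG.
congr (P _); apply/seteqP; split=> w [] /=;
  rewrite (dynamics_update dyn) => + Gw;
  by case: Gw => /= xE; rewrite xE update_constant; split => //; [left|right].
Qed.

End mixtures.

(** * Realization of the dynamics *)

Section independent_bits.
Context d (T : measurableType d) (R : realType) (Q : probability T R).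
Variables (alpha : R) (bit : nat -> T -> bool).
Hypothesis alpha01 : 0 <= alpha <= 1.
Hypothesis mbit : forall n, measurable_fun [set: T] (bit n).
Hypothesis bit_prefix : forall (n : nat) (v : nat -> bool),
  Q [set x | forall k, (k < n)%N -> bit k x = v k] =
  (\prod_(0 <= k < n) coin_weight alpha (v k))%:E.

(* Interpolates between cylinders of prescribed bits (m = 0) and product events
   (m = n). *)
Let mixed (B : nat -> set bool) (v : nat -> bool) (m n : nat) : set T :=
  [set x | (forall k, (k < m)%N -> B k (bit k x)) /\
           (forall k, (m <= k < n)%N -> bit k x = v k)].

Let measurable_bit n (B : set bool) : measurable [set x | B (bit n x)].
Proof. by rewrite -[X in measurable X]setTI; exact: mbit. Qed.

Let measurable_mixed B v m n : measurable (mixed B v m n).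
Proof.
rewrite (_ : mixed B v m n =
   (\bigcap_(k in [set k | (k < m)%N]) [set x | B k (bit k x)]) `&`
   (\bigcap_(k in [set k | (m <= k < n)%N]) [set x | [set v k] (bit k x)])).
  by apply: measurableI; apply: bigcap_measurableType => k _; exact: measurable_bit.
by apply/seteqP; split.
Qed.

(** By induction on m: the condition that bit m lies in [B m] is split over the two values of this
    bit, and each allowed value gives an event with one more prescribed bit, [vb b] being [v] with
    value b at m. *)
Let mixed_prob B n m : forall v, (m <= n)%N ->
  Q (mixed B v m n) =
  ((\prod_(0 <= k < m) fine (bernoulli_prob alpha (B k)))
   * \prod_(m <= k < n) coin_weight alpha (v k))%:E.
Proof.
elim: m => [|m IHm] v mn.
  rewrite big_nil mul1r -bit_prefix; congr (Q _).
  by apply/seteqP; split=> [x [_ h]|x h]; [|split].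
pose vb b k := if k == m then b else v k.
have QX b : Q (mixed B v m.+1 n `&` [set x | bit m x = b]) =
    ((b \in B m)%:R%:E * Q (mixed B (vb b) m n))%E.
  have [/set_mem Bb|/negP nBb] := boolP (b \in B m).
    rewrite mul1e; congr (Q _); apply/seteqP; split=> x.
      move=> [[h1 h2] /= xb]; split=> k.
        by move=> km; apply: h1; rewrite ltnW.
      rewrite /vb leq_eqVlt (eq_sym k); case: eqP => [<- _|_] //=.
      exact: h2.
    move=> [h1 h2]; have xb : bit m x = b.
      by rewrite h2 ?leqnn//= /vb eqxx.
    split=> //; split=> k.
      rewrite ltnS leq_eqVlt => /orP[/eqP->|/h1//]; by rewrite xb.
    move=> /andP[mk kn]; rewrite h2 ?(ltnW mk)// /vb.
    by rewrite gtn_eqF.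
  rewrite mul0e (_ : _ `&` _ = set0) ?measure0//; apply/seteqP; split=> x //=.
  by move=> [[h1 _] xb]; apply: nBb; rewrite -xb; apply/mem_set/h1.
have mb b : measurable [set x | bit m x = b] by exact: (measurable_bit m [set b]).
have -> : Q (mixed B v m.+1 n) =
    (Q (mixed B v m.+1 n `&` [set x | bit m x = true]) +
     Q (mixed B v m.+1 n `&` [set x | bit m x = false]))%E.
  rewrite -measureU; do ?[exact: measurableI]; last first.
    by apply/seteqP; split=> x //= [[_ ->] []].
  congr (Q _); rewrite -setIUr; apply/esym/setIidPl => x _ /=.
  by case: (bit m x); [left|right].
rewrite !QX !IHm ?(ltnW mn)//.
have vE b : \prod_(m <= k < n) coin_weight alpha (vb b k) =
    coin_weight alpha b * \prod_(m.+1 <= k < n) coin_weight alpha (v k).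
  rewrite big_ltn// /vb eqxx; congr (_ * _).
  by apply: eq_big_nat => k /andP[mk _]; rewrite gtn_eqF.
rewrite !vE big_nat_recr//= bernoulli_probE// !diracE.
rewrite -!EFinM -!EFinD; congr EFin; rewrite /= /unstable.onem; ring.
Qed.

(** Any finite family of indices sits in a prefix; the missing indices receive the full set [setT],
    which contributes a factor 1. *)
Lemma bits_independent (s : seq nat) (B : nat -> set bool) : uniq s ->
  Q (\bigcap_(k in [set` s]) bit k @^-1` B k) =
  (\prod_(k <- s) bernoulli_prob alpha (B k))%E.
Proof.
move=> us; pose n := (\max_(k <- s) k).+1.
have sn k : k \in s -> (k < n)%N by move=> ks; rewrite ltnS leq_bigmax_seq.
pose B' k := if k \in s then B k else setT.
rewrite (_ : \bigcap_(_ in _) _ = mixed B' (fun=> true) n n); last first.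
  apply/seteqP; split=> x.
    move=> h; split=> k; last by rewrite ltnNge andbN.
    by move=> _; rewrite /B'; case: ifP => // ks; exact: h.
  by move=> [h _] k /= ks; have := h k (sn k ks); rewrite /B' ks.
rewrite mixed_prob// [X in _ * X]big_geq// mulr1.
rewrite (eq_bigr (fun k => (fine (bernoulli_prob alpha (B k)))%:E)); last first.
  by move=> k _; rewrite fineK// fin_num_measure.
rewrite prodEFin; congr EFin.
rewrite [RHS](perm_big [seq k <- index_iota 0 n | k \in s]); last first.
  apply: uniq_perm => //; first by rewrite filter_uniq// iota_uniq.
  move=> k; rewrite mem_filter mem_index_iota /=.
  by case: (boolP (k \in s)) => //= /sn ->.
rewrite big_filter [RHS]big_mkcond; apply: eq_bigr => k _.
rewrite /B'; case: ifP => // _.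
by rewrite probability_setT.
Qed.

End independent_bits.

(** Separates the factor of the initial configuration, indexed by [None], from those of the
    coins. *)
Lemma prod_option (R : realDomainType) (T : eqType) (s : seq (option T))
    (f : option T -> \bar R) : uniq s ->
  (\prod_(k <- s) f k =
   (if None \in s then f None else 1) * \prod_(k <- pmap id s) f (Some k))%E.
Proof.
elim: s => [|[k|] s IHs] /=; first by rewrite !big_nil mule1.
  by move=> /andP[_ us]; rewrite !big_cons IHs// inE muleCA.
by move=> /andP[/negbTE Ns us]; rewrite big_cons IHs// Ns mul1e.
Qed.

(** * Digits of a uniform variable *)

Section digits.
Context (R : realType) (alpha : R).
Hypothesis alpha01 : 0 < alpha < 1.

Definition expand (x : R) : R :=
  if x < alpha then x / alpha else (x - alpha) / (1 - alpha).

Definition digit (n : nat) (x : R) : bool := iter n expand x < alpha.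

Lemma measurable_expand : measurable_fun [set: R] expand.
Proof.
apply: measurable_fun_ifT.
- exact: measurable_fun_ltr.
- exact: measurable_funM.
- by apply: measurable_funM => //; exact: measurable_funB.
Qed.

Lemma measurable_digit (n : nat) : measurable_fun [set: R] (digit n).
Proof.
apply: measurable_fun_ltr => //; elim: n => [|n IHn]; first exact: measurable_id.
exact: (measurableT_comp measurable_expand IHn).
Qed.

(** Digit 0 selects an affine branch of [expand], and the later digits are those of [expand x].
    Pulling the interval for the shifted prefix back through that branch multiplies its length by
    the weight of digit 0. *)
Lemma digit_prefix_interval (n : nat) (v : nat -> bool)
    (l := \prod_(0 <= k < n) coin_weight alpha (v k)) :
  exists a, [/\ 0 <= a, a + l <= 1 & forall x, 0 <= x < 1 ->
    ((forall k, (k < n)%N -> digit k x = v k) <-> a <= x < a + l)].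
Proof.
have [a0 a1] := andP alpha01; have b0 : 0 < 1 - alpha by rewrite subr_gt0.
rewrite {}/l; elim: n v => [|n IHn] v.
  by exists 0; rewrite big_nil add0r; split.
have [a []] := IHn (v \o succn).
rewrite big_nat_recl//=; set l := \prod_(_ <= _ < _) _ => a_ge0 al1 aP.
have digits_cons x : (forall k, (k < n.+1)%N -> digit k x = v k) <->
    (x < alpha) = v 0%N /\
    (forall k, (k < n)%N -> digit k (expand x) = v k.+1).
  split=> [h|[h0 h] [|k] kn].
  - split=> [|k kn]; first exact: (h 0%N).
    by rewrite /digit -iterSr; exact: (h k.+1).
  - exact: h0.
  - by rewrite /digit iterSr; exact: h.
have l_ge0 : 0 <= l.
  apply: prodr_ge0 => k _; rewrite /coin_weight; case: ifP => _; exact: ltW.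
case v0 : (v 0%N); rewrite /coin_weight /=.
(* Left endpoint of the preimage of [a, a + l[ under x / alpha; the other branch is inverted in the
   same way below. *)
- exists (alpha * a); split; [nra|nra|] => x x01.
  rewrite digits_cons v0 /expand; split=> [[xa]|/andP[h1 h2]].
    have x'01 : 0 <= x / alpha < 1.
      by rewrite divr_ge0 ?ltr_pdivrMr// ?(ltW a0)//; lra.
    rewrite xa => /(aP _ x'01).1.
    by rewrite ler_pdivlMr// ltr_pdivrMr// => /andP[? ?]; apply/andP; split; lra.
  have xa : x < alpha by nra.
  split=> //; rewrite xa; apply/aP.
    by rewrite divr_ge0 ?ltr_pdivrMr// ?(ltW a0)//; lra.
  by rewrite ler_pdivlMr// ltr_pdivrMr//; lra.
- exists (alpha + (1 - alpha) * a); split; [nra|nra|] => x x01.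
  rewrite digits_cons v0 /expand; split=> [[xa]|/andP[h1 h2]].
    have alx : alpha <= x by rewrite leNgt xa.
    have x'01 : 0 <= (x - alpha) / (1 - alpha) < 1.
      by rewrite divr_ge0 ?ltr_pdivrMr// ?(ltW b0)//; lra.
    rewrite xa => /(aP _ x'01).1.
    by rewrite ler_pdivlMr// ltr_pdivrMr// => /andP[? ?]; apply/andP; split; lra.
  have xa : (x < alpha) = false by apply/negbTE; rewrite -leNgt; nra.
  split=> //; rewrite xa; apply/aP.
    move/negbT: xa; rewrite -leNgt => xa.
    by rewrite divr_ge0 ?ltr_pdivrMr// ?(ltW b0)//; lra.
  by rewrite ler_pdivlMr// ltr_pdivrMr//; lra.
Qed.

Let Q : probability (measurableTypeR R) R := uniform_prob (@ltr01 R).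

Lemma uniform_prob_itv (a b : R) : 0 <= a -> a <= b -> b <= 1 ->
  Q `[a, b[%classic = (b - a)%:E.
Proof.
move=> a0 ab b1; rewrite /Q /= /uniform_prob.
rewrite (eq_integral (fun=> 1%:E)); last first.
  move=> x; rewrite inE /= in_itv /= => /andP[ax xb].
  by rewrite /uniform_pdf (le_trans a0 ax) (le_trans (ltW xb) b1) /= subr0 invr1.
rewrite integral_cst//= mul1e lebesgue_measure_itv/= lte_fin.
by case: ltgtP ab => // -> _; rewrite subrr.
Qed.

Lemma digit_prefix_prob (n : nat) (v : nat -> bool) :
  Q [set x | forall k, (k < n)%N -> digit k x = v k] =
  (\prod_(0 <= k < n) coin_weight alpha (v k))%:E.
Proof.
have [a [a0 al1 aP]] := digit_prefix_interval n v.
set l := \prod_(_ <= _ < _) _ in al1 aP *.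
have mX : measurable [set x | forall k, (k < n)%N -> digit k x = v k].
  rewrite (_ : [set x | _] = \bigcap_(k in [set k | (k < n)%N])
      digit k @^-1` [set v k]) //.
  apply: bigcap_measurableType => k _; rewrite -[X in measurable X]setTI.
  exact: measurable_digit.
have l0 : 0 <= l.
  have [al0 al'1] := andP alpha01; apply: prodr_ge0 => k _.
  rewrite /coin_weight; case: ifP => _; lra.
(* The interval describes the prefix event only inside [0, 1[, which has full mass. *)
have Q1 : Q (~` `[0, 1[%classic) = 0%E.
  by rewrite probability_setC// uniform_prob_itv// subr0 subee.
have -> : Q [set x | forall k, (k < n)%N -> digit k x = v k] = Q `[a, a + l[%classic.
  transitivity (Q ([set x | forall k, (k < n)%N -> digit k x = v k] `&` `[0, 1[%classic)).
    exact: full_measure_setI.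
  congr (Q _); apply/seteqP; split=> x /=; rewrite !in_itv/=.
    by move=> [h x01]; apply/aP.
  move=> h; have x01 : 0 <= x < 1 by lra.
  by split=> //; apply/aP.
by rewrite uniform_prob_itv//; [congr EFin; lra|lra].
Qed.

End digits.

(** * Coins and states on the product space *)

Section dynamics_existence.
Context (R : realType) (alpha : R) (mu : probability config R).
Hypothesis alpha01 : 0 < alpha < 1.

Let Q : probability (measurableTypeR R) R := uniform_prob (@ltr01 R).
Let Omega := (config * measurableTypeR R)%type.
Let P : probability Omega R := (mu \x Q)%E.

(** Since [pickle] is injective, distinct coins read distinct digits. *)
Definition coin_fun (c : colour) (i : int) (t : nat) (w : Omega) : bool :=
  digit alpha (pickle (c, i, t)) w.2.

Let measurable_coin_fun c i t : measurable_fun [set: Omega] (coin_fun c i t).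
Proof. exact: (measurableT_comp (measurable_digit _ _) measurable_snd). Qed.

HB.instance Definition _ c i t :=
  isMeasurableFun.Build _ _ Omega bool (coin_fun c i t) (measurable_coin_fun c i t).

Fixpoint state_fun (t : nat) (w : Omega) : config :=
  if t is t'.+1 then update (fun c i => coin_fun c i t' w) (state_fun t' w)
  else w.1.

Let measurable_state_fun t : measurable_fun [set: Omega] (state_fun t).
Proof.
elim: t => [|t IHt]; first exact: measurable_fst.
have mx i : measurable_fun [set: Omega] (fun w => state_fun t w i : bool).
  exact: (measurableT_comp (measurable_coordinate i) IHt).
have mc i : measurable_fun [set: Omega]
    (fun w => coin_fun (state_fun t w i) i t w).
  rewrite (_ : (fun _ => _) = (fun w => if state_fun t w i
      then coin_fun true i t w else coin_fun false i t w)).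
    exact: measurable_fun_ifT.
  by apply/funext => w; case: (state_fun t w i).
apply: measurable_fun_config => i /=.
rewrite (_ : (fun _ => _) = (fun w => state_fun t w i !=
  (~~ coin_fun (state_fun t w i) i t w &&
    (((state_fun t w (i - 1) != state_fun t w i)
        && coin_fun (state_fun t w (i - 1)) (i - 1) t w) ||
     ((state_fun t w (i + 1) != state_fun t w i)
        && coin_fun (state_fun t w (i + 1)) (i + 1) t w))))); last first.
  by apply/funext => w; rewrite updateE -negb_eqb.
by do ?[apply: measurable_and|apply: measurable_or|apply: measurable_neg|
  apply: measurable_eqb].
Qed.

HB.instance Definition _ t :=
  isMeasurableFun.Build _ _ Omega config (state_fun t) (measurable_state_fun t).

Let coin c i t : {RV P >-> bool} := coin_fun c i t.
Let state t : {RV P >-> config} := state_fun t.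

(** The event is a rectangle: the initial configuration is the first coordinate and all coins are
    functions of the second, so the product measure factors and independence of the digits does the
    rest. *)
Let coins_independent (B0 : set config) (s : seq (colour * int * nat))
    (B : colour * int * nat -> set bool) : measurable B0 -> uniq s ->
  P (state 0 @^-1` B0 `&`
     \bigcap_(k in [set` s]) coin k.1.1 k.1.2 k.2 @^-1` B k) =
  (mu B0 * \prod_(k <- s) bernoulli_prob alpha (B k))%E.
Proof.
move=> mB0 us.
(* Integers that encode no coin get the default [setT]; only codes of elements of [s] are
   evaluated. *)
pose B' n := if unpickle n is Some k then B k else setT.
pose Y := \bigcap_(n in [set` map pickle s]) digit alpha n @^-1` B' n.
have mY : measurable (Y : set (measurableTypeR R)).
  apply: bigcap_measurableType => n _; rewrite -[X in measurable X]setTI.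
  exact: measurable_digit.
rewrite (_ : _ `&` _ = B0 `*` Y); last first.
  apply/seteqP; split=> -[x u] /= [B0x h]; split=> //=.
    move=> _ /mapP[[[c i] t] ks ->]; rewrite /B' pickleK; exact: (h (c, i, t)).
  move=> [[c i] t] ks; have := h (pickle (c, i, t)); rewrite /B' pickleK; apply.
  exact: map_f.
apply: etrans (product_measure1E mu Q mB0 mY) _; congr (_ * _)%E.
have a01 : 0 <= alpha <= 1 by case/andP: alpha01 => /ltW -> /ltW.
have us' : uniq (map pickle s).
  by rewrite map_inj_uniq//; exact: (pcan_inj pickleK).
apply: etrans (@bits_independent _ _ R Q alpha (digit alpha) a01
  (measurable_digit alpha) (digit_prefix_prob alpha01) _ B' us') _.
by rewrite big_map; apply: eq_bigr => k _; rewrite /B' pickleK.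
Qed.

Let state0_law (B0 : set config) : measurable B0 ->
  P (state 0 @^-1` B0) = mu B0.
Proof.
move=> mB0; have := coins_independent (s := [::]) (fun=> setT) mB0 isT.
rewrite big_nil mule1 => <-; congr (P _).
by apply/seteqP; split=> [w|w []].
Qed.

Let coin_law (k : colour * int * nat) (B : set bool) :
  P (coin k.1.1 k.1.2 k.2 @^-1` B) = bernoulli_prob alpha B.
Proof.
have := coins_independent (s := [:: k]) (fun=> B) measurableT isT.
rewrite big_seq1 probability_setT mul1e => <-; congr (P _).
apply/seteqP; split=> w /=.
  by move=> Bw; split=> // k' /=; rewrite inE => /eqP ->.
by move=> [_ /(_ k)]; apply; rewrite /= mem_head.
Qed.

Lemma dynamics_exist :
  exists (xi : nat -> {RV P >-> config})
         (C : colour -> int -> nat -> {RV P >-> bool}),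
  chameleon_dynamics alpha xi C /\ has_law (xi 0%N) mu.
Proof.
exists state, coin; split; last exact: state0_law.
split=> // [c i t B _|s A us sA]; first exact: (coin_law (c, i, t)).
have [B0 [mB0 AB0]] : exists B0 : set config,
    measurable B0 /\ (None \in s -> A None = state 0 @^-1` B0).
  have [Ns|] := boolP (None \in s); last by exists setT.
  by have [B0 mB0 <-] := sA _ Ns; exists B0; rewrite setTI.
have /choice[B AB] : forall k : colour * int * nat, exists B : set bool,
    Some k \in s -> A (Some k) = coin k.1.1 k.1.2 k.2 @^-1` B.
  move=> [[c i] t]; have [ks|] := boolP (Some (c, i, t) \in s); last by exists setT.
  by have [B mB <-] := sA _ ks; exists B; rewrite setTI.
(* If [None] is absent from [s], the initial configuration is unconstrained and contributes a factor
   1. *)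
pose B0' := if None \in s then B0 else setT.
have mB0' : measurable B0' by rewrite /B0'; case: ifP.
have mem_s k : (k \in pmap id s) = (Some k \in s) by rewrite mem_pmap map_id.
rewrite (_ : \bigcap_(_ in _) _ = state 0 @^-1` B0' `&`
    \bigcap_(k in [set` pmap id s]) coin k.1.1 k.1.2 k.2 @^-1` B k); last first.
  apply/seteqP; split=> w.
    move=> h; split=> [|k /=].
      by rewrite /B0'; case: ifP => //= Ns; have := h None Ns; rewrite AB0.
    by rewrite mem_s => ks; have := h _ ks; rewrite AB.
  move=> [h0 h] [k|] /= ks; first by rewrite AB//; apply: h; rewrite /= mem_s.
  by move: h0; rewrite AB0// /B0' ks.
rewrite coins_independent//; last first.
  by apply: (@pmap_uniq _ _ id Some) => // -[].
rewrite prod_option//; congr (_ * _)%E.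
  rewrite /B0'; case: ifPn => Ns; last exact: probability_setT.
  by rewrite AB0// state0_law.
rewrite big_seq [RHS]big_seq; apply: eq_bigr => k; rewrite mem_s => ks.
by rewrite AB// coin_law.
Qed.

End dynamics_existence.

Theorem corollary9 (R : realType) (alpha : R) (halpha : 0 < alpha < 1)
    (mu : probability config R) :
  translation_invariant mu /\ stationary alpha mu <->
  exists kappa : R, 0 <= kappa <= 1 /\
    forall A : set config, measurable A ->
      mu A = (kappa%:E * \d_all_red A + (1 - kappa)%:E * \d_all_blue A)%E.
Proof.
split=> [[mu_shift mu_stat]|[kappa [_ muE]]]; last first.
  split; first exact: mixture_translation_invariant muE.
  exact: mixture_stationary muE _.
(* As [stationary] quantifies over realizations of the dynamics, one started from [mu] must be
   supplied to exploit it. *)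
have [xi [C [dyn law0]]] := dynamics_exist mu halpha.
have law1 := mu_stat _ _ _ _ _ dyn law0.
apply: monochrome_mixture => A mA; apply: monochrome_measure => // i.
exact: (interface_null halpha dyn law0 law1 mu_shift).
Qed.
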